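(* Let $C$ be a complete set of diameter one in a normed plane, and suppose that $C$ is not a Reuleaux polygon. Then for every positive integer $k$, $a_k(C)=2k+1$.
   Context: A normed plane is $\mathbb{R}^2$ equipped with a norm, with closed unit ball $\mathbf{B}$; diameters are taken with respect to this norm. A bounded set $C$ is complete if no set of the same diameter properly contains $C$. A complete set $C$ of diameter one is a Reuleaux polygon if it is the intersection of finitely many translates of $\mathbf{B}$. For a set $S$ of diameter $d>0$, the $k$-fold Borsuk number $a_k(S)$ is the smallest cardinality of an (indexed) family $\mathcal{F}$ of subsets of $S$, each of diameter strictly less than $d$, such that every point of $S$ belongs to at least $k$ members of $\mathcal{F}$. *)

(* Defs.v *)
(* MathComp-Analysis; the reals are an arbitrary R : realType. *)
From mathcomp Require Import all_boot all_order all_algebra.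
From mathcomp Require Import all_classical all_reals ereal.

Set Implicit Arguments.
Unset Strict Implicit.
Unset Printing Implicit Defensive.

Import Order.TTheory GRing.Theory Num.Theory.
Local Open Scope classical_set_scope.
Local Open Scope ring_scope.

(* 'rV[R]_2 only provides the vector space R^2: the norm N of the plane is an
   explicit function, unrelated to the library's max norm on row vectors.
   Nonnegativity of N follows from these axioms. *)
Definition is_norm (R : realType) (N : 'rV[R]_2 -> R) : Prop :=
  [/\ forall x, N x = 0 -> x = 0,
      forall (a : R) x, N (a *: x) = `|a| * N x
    & forall x y, N (x + y) <= N x + N y].

Definition unit_ball (R : realType) (N : 'rV[R]_2 -> R) : set 'rV[R]_2 :=
  [set x | N x <= 1].

Definition norm_bounded (R : realType) (N : 'rV[R]_2 -> R)
    (S : set 'rV[R]_2) : Prop :=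
  exists M : R, forall x, S x -> N x <= M.

(* Extended-real valued: +oo on unbounded sets. The empty set gets -oo rather
   than 0, which does not matter when comparing with a positive diameter. *)
Definition diam (R : realType) (N : 'rV[R]_2 -> R)
    (S : set 'rV[R]_2) : \bar R :=
  ereal_sup [set (N (x - y))%:E | x in S & y in S].

Definition complete_set (R : realType) (N : 'rV[R]_2 -> R)
    (C : set 'rV[R]_2) : Prop :=
  norm_bounded N C /\
  ~ exists D : set 'rV[R]_2, C `<` D /\ diam N D = diam N C.

Definition reuleaux_polygon (R : realType) (N : 'rV[R]_2 -> R)
    (C : set 'rV[R]_2) : Prop :=
  [/\ complete_set N C,
      diam N C = 1%:E
    & exists s : seq 'rV[R]_2,
        C = \bigcap_(p in [set` s]) ((fun b => p + b) @` unit_ball N)].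

(* The family is indexed, so a subset occurring at several indices counts
   with multiplicity, both in n and in the number of times x is covered. *)
Definition has_kfold_cover (R : realType) (N : 'rV[R]_2 -> R) (k : nat)
    (S : set 'rV[R]_2) (n : nat) : Prop :=
  exists F : 'I_n -> set 'rV[R]_2,
    (forall i, F i `<=` S /\ (diam N (F i) < diam N S)%E) /\
    (forall x, S x -> (k <= #|[pred i | x \in F i]|)%N).

(* a_k(S) = n, as a predicate since no finite cover need exist for arbitrary
   S. Infinite families are irrelevant to a finite minimum. *)
Definition is_kfold_borsuk_number (R : realType) (N : 'rV[R]_2 -> R)
    (k : nat) (S : set 'rV[R]_2) (n : nat) : Prop :=
  has_kfold_cover N k S n /\
  forall m : nat, has_kfold_cover N k S m -> (n <= m)%N.

(* Main.v *)
Require Import Defs.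
From mathcomp Require Import all_boot all_order all_algebra.
From mathcomp Require Import all_classical all_reals ereal.
From mathcomp Require Import topology normedtype derive trigo.
From mathcomp Require Import ring lra zify.
From mathcomp Require finmap.

(* Lower bound: every boundary point x of C has an antipode x' in C with
   N (x - x') = 1, and no member of a cover contains both in its closure. With
   at most 2k members, each boundary point would lie in exactly k closures and
   its antipode in the complementary ones; but the set of closures containing
   a boundary point is locally constant along the connected boundary.

   Upper bound: parametrize the boundary by the polar angle about an interior
   point and let f t be the first antipode after t. Two diametral chords whose
   endpoints do not interlace are opposite sides of a convex quadrilateral, so
   its diagonals are diametral too; hence f is monotone and f (f t) <= t + 2 pi.
   If the decreasing orbit of t |-> f (f t) - 2 pi makes a full turn, finitely
   many unit balls centred at antipodes touch the whole boundary, and C is a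
   Reuleaux polygon. Otherwise the orbit accumulates, and 2k+1 steps of f from
   one of its late points advance by more than k turns. By left continuity
   there are y_0, ..., y_(2k+1) = y_0 + 2 pi k with y_(j+1) < f (y_j); the
   sectors over the arcs [y_j, y_(j+1)] have diameter less than one and wind k
   times around C. *)

Set Implicit Arguments.
Unset Strict Implicit.
Unset Printing Implicit Defensive.

Import Order.TTheory GRing.Theory Num.Theory.
Import numFieldNormedType.Exports.
Local Open Scope classical_set_scope.
Local Open Scope ring_scope.

(** * Antipodal maps of a circle *)

Section Circle.
(** [D s t] stands for the distance between the boundary points at angles [s] and [t], and [T] for
    the full turn. Angles stay on the real line, so that winding can be counted. *)
Context {R : realType} (T : R) (D : R -> R -> R).
Hypothesis Dsym : forall s t, D s t = D t s.
Hypothesis Dper : forall s t, D s (t + T) = D s t.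
Hypothesis D0 : forall t, D t t = 0.
Hypothesis D_le1 : forall s t, D s t <= 1.
Hypothesis D_open : forall s t, D s t < 1 -> exists2 e : R, 0 < e &
  forall s' t', `|s' - s| < e -> `|t' - t| < e -> D s' t' < 1.
Hypothesis D_ex : forall t : R, exists s : R, [/\ t < s, s < t + T & D t s = 1].
Hypothesis D_cross : forall a b c d : R, a < b -> b < c -> c < d -> d < a + T ->
  D a d = 1 -> D b c = 1 -> D a c = 1 /\ D b d = 1.

Definition antipode (t : R) : R := inf [set s | t <= s /\ D t s = 1].
Local Notation f := antipode.

Let has_inf_antipode t : has_inf [set s | t <= s /\ D t s = 1].
Proof.
split; last by exists t => s [].
by have [s [ts _ Ds]] := D_ex t; exists s; split; first exact: ltW.
Qed.

Lemma antipode_le t s : t <= s -> D t s = 1 -> f t <= s.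
Proof. by move=> ts Ds; apply: ge_inf => //; have [] := has_inf_antipode t. Qed.

(** The condition [D t s < 1] is open, so the infimum is attained. *)
Lemma D_antipode t : D t (f t) = 1.
Proof.
apply/eqP; rewrite eq_le D_le1 leNgt; apply/negP => /D_open[e e0 De].
have [s [ts Ds] sf] := inf_adherent e0 (has_inf_antipode t).
have fs := antipode_le ts Ds.
have : D t s < 1.
  by apply: De; rewrite ?subrr ?normr0// ger0_norm ?subr_ge0// ltrBlDl.
by rewrite Ds ltxx.
Qed.

Lemma antipode_gt t : t < f t.
Proof.
have tf : t <= f t.
  by apply: lb_le_inf; [have [] := has_inf_antipode t | move=> s []].
rewrite lt_neqAle tf andbT; apply/eqP => tE.
by have := D_antipode t; rewrite -tE D0 => /eqP; rewrite eq_sym oner_eq0.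
Qed.

Lemma antipode_lt t : f t < t + T.
Proof.
have [s [ts sT Ds]] := D_ex t.
by apply: le_lt_trans sT; apply: antipode_le => //; exact: ltW.
Qed.

Lemma antipode2_le t : f (f t) <= t + T.
Proof.
apply: antipode_le; first exact/ltW/antipode_lt.
by rewrite Dper Dsym D_antipode.
Qed.

Lemma antipodeDT t : f (t + T) = f t + T.
Proof.
apply/eqP; rewrite eq_le; apply/andP; split.
  apply: antipode_le; first by rewrite lerD2r ltW ?antipode_gt.
  by rewrite Dper Dsym Dper Dsym D_antipode.
have H s : D (t + T) s = D t s by rewrite Dsym Dper Dsym.
rewrite -lerBrDr; apply: antipode_le.
  by rewrite lerBrDr ltW ?antipode_gt.
by rewrite -Dper subrK -H D_antipode.
Qed.

(** If [f t < f s] with [s < t], the chord from [t] to [f t] is nested in that from [s] to [f s]. By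
    [D_cross] the diagonal from [s] to [f t] is diametral, so [f s] was not the first antipode. *)
Lemma antipode_homo : {homo f : s t / s <= t}.
Proof.
move=> s t; rewrite le_eqVlt => /orP[/eqP->//|st].
rewrite leNgt; apply/negP => fts.
have [H _] := D_cross st (antipode_gt t) fts (antipode_lt s)
  (D_antipode s) (D_antipode t).
suff : f s <= f t by rewrite leNgt fts.
by apply: antipode_le H; rewrite ltW// (lt_trans st) ?antipode_gt.
Qed.

(** Left continuity, in the form that monotonicity allows. Let L be the supremum of [f] to the left
    of [t]. By openness [D t L = 1], and [t <= L], so [f t <= L]. *)
Lemma antipode_lcont t c : c < f t ->
  exists2 c', c' < t & forall z, c' < z -> c < f z.
Proof.
move=> cft; apply: contrapT => H.
have {}H z : z < t -> f z <= c.
  move=> zt; rewrite leNgt; apply/negP => cfz; apply: H.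
  exists z => // z' zz'; apply: lt_le_trans cfz _.
  exact/antipode_homo/ltW.
pose S := f @` [set z | z < t].
have Sne : S !=set0.
  by exists (f (t - 1)), (t - 1) => //=; rewrite ltrBlDr ltrDl.
have hS : has_sup S by split => //; exists c => _ [z zt <-]; exact: H.
have Lc : sup S <= c by apply: ge_sup => // _ [z zt <-]; exact: H.
have fL z : z < t -> f z <= sup S.
  by move=> zt; apply: ub_le_sup; [case: hS | exists z].
have tL : t <= sup S.
  rewrite leNgt; apply/negP => Lt.
  have : f ((sup S + t) / 2) <= sup S by apply: fL; lra.
  by have := antipode_gt ((sup S + t) / 2); lra.
suff DL : D t (sup S) = 1 by have := antipode_le tL DL; lra.
apply/eqP; rewrite eq_le D_le1 leNgt; apply/negP => /D_open[e e0 De].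
have [_ [z /= zt <-] Lz] := sup_adherent e0 hS.
pose z' := Num.max z (t - e / 2).
have z't : z' < t by rewrite gt_max zt /=; lra.
have fzz' : f z <= f z' by apply: antipode_homo; rewrite le_max lexx.
have tz' : t - e / 2 <= z' by rewrite le_max lexx orbT.
have : D z' (f z') < 1.
  have fLz' := fL _ z't.
  by apply: De; rewrite ltr_norml; apply/andP; split; lra.
by rewrite D_antipode ltxx.
Qed.

(** Trades exact steps of [f] for strictly shorter ones. The slack at the end is carried back to the
    previous point by left continuity, one step at a time. *)
Lemma antipode_chain n a c : c < f (iter n f a) ->
  exists y : nat -> R, [/\ y 0 = a, c < f (y n) &
    forall j, (j < n)%N -> y j.+1 < f (y j)].
Proof.
elim: n c => [|n IHn] c /= H; first by exists (fun=> a).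
have [c' c'lt Hc'] := antipode_lcont H.
have [y [y0 c'y yS]] := IHn _ c'lt.
pose z := (c' + f (y n)) / 2.
exists (fun j => if (j <= n)%N then y j else z); split => //.
  by rewrite ltnn; apply: Hc'; rewrite /z; lra.
move=> j; rewrite ltnS => jn; rewrite jn; case: ltnP => [/yS//|nj].
by have -> : j = n; [lia | rewrite /z; lra].
Qed.

Definition half_turn2 (t : R) : R := f (f t) - T.
Local Notation h := half_turn2.

Lemma half_turn2_le t : h t <= t.
Proof. by rewrite /h lerBlDr antipode2_le. Qed.

Lemma antipodeDnT n t : f (t + T *+ n) = f t + T *+ n.
Proof.
by elim: n => [|n IHn]; rewrite ?mulr0n ?addr0// mulrSr !addrA antipodeDT IHn.
Qed.

Lemma iter_half_turn2 n t : iter (2 * n) f t = iter n h t + T *+ n.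
Proof.
elim: n => [|n IHn]; first by rewrite mulr0n addr0.
rewrite mulnS /= -/f IHn !antipodeDnT /h mulrS; ring.
Qed.

(** The point [f t] is an antipode of both [t] and [h t]. For [s] in between with [f s < f t], the
    chord from [s] to [f s] is nested in that from [h t] to [f t], and [D_cross] applies. *)
Lemma D_between t s : h t <= s -> s <= t -> D s (f t) = 1.
Proof.
move=> hts st; have := antipode_homo st; rewrite le_eqVlt => /orP[/eqP<-|].
  exact: D_antipode.
move: hts; rewrite le_eqVlt => /orP[/eqP<- _|hts fst].
  by rewrite Dsym -(Dper _ (h t)) /h subrK D_antipode.
have H1 : D (h t) (f t) = 1 by rewrite Dsym -Dper /h subrK D_antipode.
have H2 : f t < h t + T by rewrite /h subrK antipode_gt.
by case: (D_cross hts (antipode_gt s) fst H2 H1 (D_antipode s)).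
Qed.

Lemma circle_dichotomy :
  (exists (n : nat) (v : nat -> R), forall s, - T <= s -> s <= 0 ->
     exists2 j, (j < n)%N & D s (v j) = 1) \/
  (forall k, exists y : nat -> R, [/\ y (2 * k).+1 = y 0%N + T *+ k,
     forall j, (j < (2 * k).+1)%N -> y j.+1 < y j + T &
     forall j, (j < (2 * k).+1)%N -> forall s t,
       y j <= s -> s <= y j.+1 -> y j <= t -> t <= y j.+1 -> D s t < 1]).
Proof.
pose e n := iter n h 0.
have eS n : e n.+1 <= e n by exact: half_turn2_le.
have [[n enT]|nb] := pselect (exists n, e n < - T).
  (* By [D_between], [f (e j)] is antipodal to all of [[e j.+1, e j]], and these intervals cover
     [[- T, 0]]. *)
  left; exists n, (fun j => f (e j)) => s sT s0.
  elim: n enT => [|n IHn] enT; first by move: s0 enT; rewrite /e/= => ? ?; lra.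
  have [/IHn[j jn Dj]|Ten] := ltP (e n) (- T).
    by exists j => //; rewrite ltnS ltnW.
  have [sen|/ltW sen] := leP s (e n).
    by exists n => //; apply: D_between => //; apply: le_trans sT; exact: ltW.
  move: sen; clear IHn enT Ten.
  elim: n => [|n IHn] sen.
    exists 0%N => //; have -> : s = e 0%N by apply/eqP; rewrite eq_le sen s0.
    exact: D_antipode.
  have [sen'|/ltW/IHn[j jn Dj]] := leP s (e n).
    by exists n => //; apply: D_between.
  by exists j => //; rewrite ltnS ltnW.
right => k.
have eT n : - T <= e n by rewrite leNgt; apply/negP => ?; apply: nb; exists n.
have hinf : has_inf (range e).
  by split; [exists (e 0%N), 0%N | exists (- T) => _ [n _ <-]].
have u_le n : inf (range e) <= e n.
  by apply: ge_inf; [case: hinf | exists n].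
set u := inf (range e) in u_le.
have fu0 : 0 < f u - u by rewrite subr_gt0 antipode_gt.
have [_ [n _ <-]] := inf_adherent fu0 hinf.
rewrite -/u addrC subrK => enfu.
(* The first [2 * k] steps lead to [e (n + k) + T *+ k]. One more reaches at least [f u + T *+ k],
   because [u <= e (n + k)], and this is beyond [e n + T *+ k]. *)
have H : e n + T *+ k < f (iter (2 * k) f (e n)).
  rewrite iter_half_turn2 antipodeDnT ltrD2r (lt_le_trans enfu)//.
  by apply: antipode_homo; rewrite /e -iterD; exact: u_le.
have [y [y0 yk yS]] := antipode_chain H.
(* Only the last point is changed: it is pulled to [e n + T *+ k], which closes the chain after
   exactly [k] turns. *)
pose y' j := if (j <= 2 * k)%N then y j else e n + T *+ k.
have y'S j : (j < (2 * k).+1)%N -> y' j.+1 < f (y' j).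
  rewrite ltnS => jk; rewrite /y' jk; case: ltnP => [/yS//|kj].
  by have -> : j = (2 * k)%N by lia.
exists y'; split.
- by rewrite /y' ltnn leq0n y0.
- by move=> j /y'S /lt_trans; apply; exact: antipode_lt.
move=> j jk.
(* A diametral pair in the arc would give [f (y' j) <= f s <= t <= y' j.+1], against [y'S]. *)
have H1 s t : y' j <= s -> s <= t -> t <= y' j.+1 -> D s t < 1.
  move=> ys st ty; rewrite lt_neqAle D_le1 andbT; apply/eqP => Dst.
  have := antipode_le st Dst; have := antipode_homo ys; have := y'S _ jk; lra.
move=> s t ys sy yt ty; have [st|/ltW st] := leP s t; first exact: H1.
by rewrite Dsym; exact: H1.
Qed.

Lemma circle_closed_cover_card (k m : nat) (G : 'I_m -> set R) : (0 < k)%N ->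
  (forall i t, ~ G i t ->
    exists2 e : R, 0 < e & forall s, `|s - t| < e -> ~ G i s) ->
  (forall i s t, G i s -> G i t -> D s t < 1) ->
  (forall t, (k <= #|[pred i | `[< G i t >]]|)%N) -> (2 * k + 1 <= m)%N.
Proof.
move=> k0 Gcl GD Gk; rewrite leqNgt addn1 ltnS; apply/negP => mk.
pose I t : {set 'I_m} := finset (fun i => `[< G i t >]).
have Idisj t : #|(I t :&: I (f t))%SET| = 0%N.
  apply: eq_card0 => i; rewrite !inE.
  apply/negP => /andP[/asboolP Gt /asboolP Gf].
  by have := GD _ _ _ Gt Gf; rewrite D_antipode ltxx.
have Icard t : #|I t| = k.
  have : (#|(I t :|: I (f t))%SET| <= m)%N.
    by rewrite -[leqRHS]card_ord max_card.
  rewrite cardsU Idisj subn0.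
  have := Gk t; have := Gk (f t).
  rewrite -(cardsE [pred i | `[< G i t >]]).
  rewrite -(cardsE [pred i | `[< G i (f t) >]]) -/(I t) -/(I (f t)).
  by move: #|I t| #|I (f t)| mk; clear; lia.
have Iloc t : exists2 e : R, 0 < e & forall s, `|s - t| < e -> I s = I t.
  have /choice[e He] i : exists e : R, 0 < e /\
      forall s, `|s - t| < e -> ~ G i t -> ~ G i s.
    have [Gt|/Gcl[e e0 He]] := pselect (G i t); first by exists 1.
    by exists e; split => // s /He.
  exists (\big[Num.min/1]_i e i).
    by apply: lt_bigmin => // i _; case: (He i).
  (* Closedness of the [G i] only gives that [I s] is contained in [I t]; equal cardinalities make
     it an equality. *)
  move=> s st; apply/eqP; rewrite eqEcard !Icard leqnn andbT.
  apply/fintype.subsetP => i; rewrite !inE => Gs.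
  apply: contrapT => nGt; have [_ Hi] := He i.
  by apply: Hi Gs => //; apply: lt_le_trans st _; exact: bigmin_le.
pose B := [set t | I t = I 0].
(* Unions of level sets of [I] are open. Applied to [B] and to its complement, this makes [B] both
   open and closed. *)
have oB (P : set R) : (forall t s, I t = I s -> P t -> P s) -> open P.
  move=> HP; rewrite openE => x Px; have [e e0 He] := Iloc x.
  exists e => //= s; rewrite /ball/= distrC => /He Is.
  by apply: HP Px; rewrite Is.
have f0 := antipode_gt 0.
pose A : set R := `[0, f 0]%classic.
have BE : A `&` B = A.
  apply: (@segment_connected _ 0 (f 0)).
  - by exists 0; split => //=; rewrite /A/= in_itv/= lexx ltW.
  - by exists B => //; apply: oB => t s ts; rewrite /B/= ts.
  - exists B => //; rewrite -(setCK B) closedC.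
    by apply: oB => t s ts; rewrite /B/= ts.
have : (A `&` B) (f 0) by rewrite BE/A/= in_itv/= lexx ltW.
case=> _; rewrite /B/= => If.
have := Idisj 0; rewrite If finset.setIid Icard => k_0.
by rewrite k_0 in k0.
Qed.

End Circle.

(** * Polar coordinates and norms in the plane *)

Section Polar.
Context {R : realType}.
Implicit Types (a b c s t : R) (v w : 'rV[R]_2).

Lemma ord2P (i : 'I_2) : i = 0 \/ i = 1.
Proof. by case: i => -[|[|//]] ?; [left|right]; apply/val_inj. Qed.

Lemma row2P v w : v 0 0 = w 0 0 -> v 0 1 = w 0 1 -> v = w.
Proof.
move=> h0 h1; apply/rowP => i.
have [->|->] := ord2P i.
- exact: h0.
- exact: h1.
Qed.

Definition polar t : 'rV[R]_2 := cos t *: delta_mx 0 0 + sin t *: delta_mx 0 1.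
Local Notation u := polar.

Lemma polar0E t : u t 0 0 = cos t.
Proof. by rewrite !mxE/= mulr1 mulr0 addr0. Qed.

Lemma polar1E t : u t 0 1 = sin t.
Proof. by rewrite !mxE/= mulr1 mulr0 add0r. Qed.

Lemma polarDT t : u (t + pi *+ 2) = u t.
Proof. by rewrite /polar cosD2pi sinD2pi. Qed.

Lemma polarDnT n t : u (t + pi *+ 2 *+ n) = u t.
Proof.
by elim: n => [|n IHn]; rewrite ?mulr0n ?addr0// mulrSr addrA polarDT.
Qed.

Lemma polar_neq0 t : u t != 0.
Proof.
apply/eqP => ut0; have := cos2Dsin2 t.
rewrite -polar0E -polar1E ut0 !mxE => /eqP.
by rewrite expr0n/= addr0 eq_sym oner_eq0.
Qed.

Lemma polar_surj v a : v != 0 ->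
  exists r s, [/\ 0 < r, a <= s, s < a + pi *+ 2 & v = r *: u s].
Proof.
move=> v0; set x := v 0 0; set y := v 0 1.
pose r := Num.sqrt (x ^+ 2 + y ^+ 2).
have r2 : r ^+ 2 = x ^+ 2 + y ^+ 2 by rewrite sqr_sqrtr// addr_ge0 ?sqr_ge0.
have r0 : 0 < r.
  rewrite lt_neqAle sqrtr_ge0 andbT eq_sym; apply: contra v0 => /eqP r0.
  move/esym/eqP: r2; rewrite r0 expr0n/= paddr_eq0 ?sqr_ge0// !sqrf_eq0.
  by case/andP=> /eqP x0 /eqP y0; apply/eqP/row2P; rewrite mxE.
(* The coordinates of [v] divided by [r] and rotated by [- a]: an angle in [[0, 2 pi)] for them,
   added to [a], falls in the required range. *)
pose x' := (x * cos a + y * sin a) / r; pose y' := (y * cos a - x * sin a) / r.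
have r'0 : r != 0 by rewrite gt_eqF.
have xy' : x' ^+ 2 + y' ^+ 2 = 1.
  have -> : x' ^+ 2 + y' ^+ 2 =
      (x ^+ 2 + y ^+ 2) * (cos a ^+ 2 + sin a ^+ 2) / r ^+ 2.
    by rewrite /x' /y'; field.
  by rewrite cos2Dsin2 mulr1 -r2 divff// expf_neq0.
have x'1 : -1 <= x' <= 1.
  rewrite -ler_norml -[leRHS]normr1 -ler_sqr ?nnegrE//.
  by rewrite !real_normK ?num_real// expr1n -xy' lerDl sqr_ge0.
have [th [th0 thT cth sth]] : exists th,
    [/\ 0 <= th, th < pi *+ 2, cos th = x' & sin th = y'].
  have pi0 := pi_gt0 R.
  have sa : sin (acos x') = `|y'|.
    by rewrite sin_acos// -xy' addrAC subrr add0r sqrtr_sqr.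
  have [y'0|y'0] := leP 0 y'.
    exists (acos x'); rewrite acos_ge0// acosK// sa ger0_norm//.
    by split => //; rewrite (le_lt_trans (acos_lepi x'1))// mulr2n ltrDl.
  exists (pi *+ 2 - acos x'); split.
  - by rewrite subr_ge0 (le_trans (acos_lepi x'1))// mulr2n lerDl ltW.
  - rewrite ltrBlDr ltrDl acos_gt0//; case/andP: x'1 => -> /=.
    rewrite lt_neqAle => -> /[!andbT]; apply/eqP => x'1.
    move: xy'; rewrite x'1 expr1n => /eqP.
    by rewrite -subr_eq0 addrAC subrr add0r sqrf_eq0 lt_eqF.
  - by rewrite addrC cosD2pi cosN acosK.
  - by rewrite addrC sinD2pi sinN sa ltr0_norm// opprK.
exists r, (a + th); split => //; [lra|lra|].
have H : (cos a ^+ 2 + sin a ^+ 2) = 1 := cos2Dsin2 a.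
have xE : x = r * cos (a + th).
  rewrite cosD cth sth /x' /y' -[LHS]mulr1 -H; field; exact: r'0.
have yE : y = r * sin (a + th).
  rewrite sinD cth sth /x' /y' -[LHS]mulr1 -H; field; exact: r'0.
by apply: row2P; rewrite mxE ?polar0E ?polar1E.
Qed.

Lemma continuous_polar : continuous u.
Proof.
move=> t; apply: cvgD; apply: cvgZr_tmp.
  exact: continuous_cos.
exact: continuous_sin.
Qed.

(** Cramer's rule for three directions; it lets subadditivity of the gauge be read off as an
    inequality in the angles. *)
Lemma polar_interp a b c :
  sin (c - a) *: u b = sin (c - b) *: u a + sin (b - a) *: u c.
Proof.
apply: row2P; rewrite !mxE !(sinB, eqxx) /=; ring.
Qed.

End Polar.

(** * Norms on the plane and its usual topology *)

Section PlaneNorm.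
Context {R : realType} (N : 'rV[R]_2 -> R).
Hypothesis hN : is_norm N.
Implicit Types (a b c s t : R) (v w : 'rV[R]_2).

Lemma pnorm0_eq0 v : N v = 0 -> v = 0.
Proof. by case: hN => H _ _; exact: H. Qed.

Lemma pnormZ a v : N (a *: v) = `|a| * N v.
Proof. by case: hN => _ H _; exact: H. Qed.

Lemma ler_pnormD v w : N (v + w) <= N v + N w.
Proof. by case: hN => _ _ H; exact: H. Qed.

Lemma pnorm0 : N 0 = 0.
Proof. by rewrite -(scale0r 0) pnormZ normr0 mul0r. Qed.

Lemma pnormN v : N (- v) = N v.
Proof. by rewrite -scaleN1r pnormZ normrN1 mul1r. Qed.

Lemma pnormB v w : N (v - w) = N (w - v).
Proof. by rewrite -pnormN opprB. Qed.

Lemma pnorm_ge0 v : 0 <= N v.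
Proof. by have := ler_pnormD v (- v); rewrite subrr pnorm0 pnormN; lra. Qed.

Lemma pnorm_gt0 v : v != 0 -> 0 < N v.
Proof.
move=> v0; rewrite lt_neqAle pnorm_ge0 andbT eq_sym.
by apply: contra v0 => /eqP/pnorm0_eq0 ->.
Qed.

Lemma ler_pnorm_trans w v v' : N (v - v') <= N (v - w) + N (w - v').
Proof. by apply: le_trans (ler_pnormD _ _); rewrite addrA subrK. Qed.

Lemma pnormZ_ge0 a v : 0 <= a -> N (a *: v) = a * N v.
Proof. by move=> a0; rewrite pnormZ ger0_norm. Qed.

Lemma pnorm_conv a v w : 0 <= a -> a <= 1 ->
  N ((1 - a) *: v + a *: w) <= (1 - a) * N v + a * N w.
Proof.
move=> a0 a1; apply: le_trans (ler_pnormD _ _) _.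
by rewrite !pnormZ_ge0 ?subr_ge0.
Qed.

Lemma pnorm_conv_sub a v w (z : 'rV[R]_2) : 0 <= a -> a <= 1 ->
  N ((1 - a) *: v + a *: w - z) <= (1 - a) * N (v - z) + a * N (w - z).
Proof.
move=> a0 a1; rewrite (_ : _ - z = (1 - a) *: (v - z) + a *: (w - z)).
  exact: pnorm_conv.
by apply: row2P; rewrite !mxE; ring.
Qed.

Lemma pnorm_le v :
  N v <= `|v 0 0| * N (delta_mx 0 0) + `|v 0 1| * N (delta_mx 0 1).
Proof.
have {1}-> : v = v 0 0 *: delta_mx 0 0 + v 0 1 *: delta_mx 0 1.
  by apply: row2P; rewrite !mxE/= ?mulr1 ?mulr0 ?addr0 ?add0r.
by rewrite (le_trans (ler_pnormD _ _))// !pnormZ.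
Qed.

Lemma ler_dist_pnorm v w : `|N v - N w| <= N (v - w).
Proof.
have := ler_pnormD (v - w) w; have := ler_pnormD (w - v) v.
by rewrite !subrK (pnormB w) ler_norml => ? ?; apply/andP; split; lra.
Qed.

Lemma near_pnorm v e : 0 < e -> \forall w \near v, N (v - w) < e.
Proof.
move=> e0; set a := N (delta_mx 0 0); set b := N (delta_mx 0 1).
have a0 : 0 <= a := pnorm_ge0 _; have b0 : 0 <= b := pnorm_ge0 _.
pose d := e / (a + b + 1).
have d0 : 0 < d by rewrite divr_gt0//; lra.
have H i : (w 0 i) @[w --> v] --> v 0 i by exact: coord_continuous.
have Hd i := (@cvgrPdist_lt _ _ _ _ (nbhs_filter v) _ _).1 (H i) d d0.
apply: (@filterS2 _ _ (nbhs_filter v)) (Hd 1) (Hd 0) => w /ltW w1 /ltW w0.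
apply: le_lt_trans (pnorm_le _) _; rewrite !mxE.
apply: le_lt_trans (_ : d * a + d * b < e).
  by rewrite lerD// ler_wpM2r.
by rewrite -mulrDr /d mulrAC ltr_pdivrMr ?ltr_pM2l; lra.
Qed.

Lemma continuous_lipschitz_pnorm (F : 'rV[R]_2 -> R) k : 0 < k ->
  (forall v w, `|F v - F w| <= k * N (v - w)) -> continuous F.
Proof.
move=> k0 Fk v; apply/(@cvgrPdist_lt _ _ _ _ (nbhs_filter v)) => e e0.
have := near_pnorm v (divr_gt0 e0 k0).
apply: (@filterS _ _ (nbhs_filter v)) => w vw.
by apply: le_lt_trans (Fk _ _) _; rewrite mulrC -ltr_pdivlMr.
Qed.

Lemma continuous_pnorm : continuous N.
Proof.
apply: (@continuous_lipschitz_pnorm _ 1) => // v w.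
by rewrite mul1r ler_dist_pnorm.
Qed.

(** One half of the equivalence of norms: by compactness [N] has a positive minimum on the Euclidean
    unit circle, whose points have coordinates at most 1 in absolute value. *)
Lemma pnorm_coord_le : exists2 m, 0 < m & forall v i, `|v 0 i| <= m * N v.
Proof.
have [c _ cmin] : exists2 c, c \in `[0, pi *+ 2]%R &
    forall t, t \in `[0, pi *+ 2]%R -> N (polar c) <= N (polar t).
  apply: EVT_min; first by rewrite mulrn_wge0 ?pi_ge0.
  apply: continuous_subspaceT => t; apply: continuous_comp.
    exact: continuous_polar.
  exact: continuous_pnorm.
have m0 := pnorm_gt0 (polar_neq0 c).
exists (N (polar c))^-1; first by rewrite invr_gt0.
move=> v i; rewrite mulrC ler_pdivlMr//.
have [->|v0] := eqVneq v 0; first by rewrite mxE normr0 mul0r pnorm_ge0.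
have [r [s [r0 s0 sT ->]]] := polar_surj 0 v0.
rewrite pnormZ mxE normrM -mulrA ler_wpM2l ?normr_ge0//.
have ui : `|polar s 0 i| <= 1.
  have [->|->] := ord2P i.
    by rewrite polar0E cos_max.
  by rewrite polar1E sin_max.
apply: le_trans (_ : 1 * N (polar c) <= _); first by rewrite ler_wpM2r// ltW.
by rewrite mul1r cmin// in_itv/= s0 -[pi *+ 2]add0r ltW.
Qed.

End PlaneNorm.

Lemma nat_crossing {R : realDomainType} (y : nat -> R) (x : R) n :
  y 0 <= x -> x < y n -> exists j, [/\ (j < n)%N, y j <= x & x < y j.+1].
Proof.
elim: n => [|n IHn] y0 xn; first by move: xn; rewrite ltNge y0.
have [xyn|/(IHn y0)[j [jn yj xj]]] := leP (y n) x; first by exists n.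
by exists j; rewrite ltnS ltnW.
Qed.

(** * Extended-real diameters against real bounds *)

Section Diam.
Context {R : realType} (N : 'rV[R]_2 -> R).
Implicit Types (S : set 'rV[R]_2) (M : R).

Lemma diam_le S M : (forall x y, S x -> S y -> N (x - y) <= M) ->
  (diam N S <= M%:E)%E.
Proof.
by move=> H; apply: ge_ereal_sup => _ [x Sx [y Sy <-]]; rewrite lee_fin H.
Qed.

Lemma le_diam S x y : S x -> S y -> ((N (x - y))%:E <= diam N S)%E.
Proof. by move=> Sx Sy; apply: ereal_sup_ubound; exists x => //; exists y. Qed.

Lemma diam_lt1 S : (diam N S < 1%:E)%E ->
  exists2 M, M < 1 & forall x y, S x -> S y -> N (x - y) <= M.
Proof.
have := @le_diam S; case: (diam N S) => [M| |] // H S1.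
  by exists M => // x y Sx Sy; rewrite -lee_fin H.
(* Diameter [-oo] means that [S] is empty, so any bound will do. *)
by exists 0 => // x y Sx Sy; have := H x y Sx Sy; rewrite leeNy_eq.
Qed.

End Diam.

(** * Planar bodies of constant diameter seen from an interior point *)

Section Body.
Context {R : realType} (N : 'rV[R]_2 -> R).
Hypothesis hN : is_norm N.
Context (C : set 'rV[R]_2) (p : 'rV[R]_2) (d : R).
Hypothesis C_le1 : forall x y, C x -> C y -> N (x - y) <= 1.
Hypothesis C_complete : forall z, (forall y, C y -> N (z - y) <= 1) -> C z.
Hypothesis d0 : 0 < d.
(** With [C_complete], this puts the ball of radius [d] about [p] inside [C]: a quantitative form of
    [p] being interior. *)
Hypothesis p_center : forall y, C y -> N (p - y) <= 1 - d.
Implicit Types (a b c s t l : R) (v w : 'rV[R]_2).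

Local Notation u := (@polar R).
Local Notation T := (pi *+ 2 : R).

Lemma body_center : C p.
Proof. by apply: C_complete => y /p_center; have := d0; lra. Qed.

(* The Minkowski gauge of [C - p]: since [C] is complete, [p + l^-1 *: v] lies
   in [C] iff it is at distance at most 1 from every [y] in [C]; clearing the
   denominator makes subadditivity immediate. *)
Definition gauge v : R :=
  inf [set l | 0 <= l /\ forall y, C y -> N (v - l *: (y - p)) <= l].
Local Notation g := gauge.

Let gauge_pnorm v : 0 <= N v / d /\
  forall y, C y -> N (v - (N v / d) *: (y - p)) <= N v / d.
Proof.
have Nvd : 0 <= N v / d by rewrite divr_ge0 ?(pnorm_ge0 hN)// ltW.
split => // y Cy; apply: le_trans (ler_pnormD hN _ _) _.
rewrite (pnormN hN) (pnormZ_ge0 hN)// (pnormB hN).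
have := ler_wpM2l Nvd (p_center Cy); rewrite mulrBr mulr1 divfK ?gt_eqF//; lra.
Qed.

Let has_inf_gauge v :
  has_inf [set l | 0 <= l /\ forall y, C y -> N (v - l *: (y - p)) <= l].
Proof. by split; [exists (N v / d); exact: gauge_pnorm | exists 0 => l []]. Qed.

Lemma gauge_ge0 v : 0 <= g v.
Proof. by apply: lb_le_inf; [case: (has_inf_gauge v) | move=> l []]. Qed.

Lemma gauge_le v l : 0 <= l ->
  (forall y, C y -> N (v - l *: (y - p)) <= l) -> g v <= l.
Proof. by move=> l0 vl; apply: ge_inf => //; case: (has_inf_gauge v). Qed.

Lemma gauge_le_pnorm v : g v <= N v / d.
Proof. by have [? ?] := gauge_pnorm v; exact: gauge_le. Qed.

Let N_py y : C y -> N (y - p) <= 1.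
Proof. by move=> Cy; apply: C_le1 => //; exact: body_center. Qed.

Lemma gaugeP v l y : g v <= l -> C y -> N (v - l *: (y - p)) <= l.
Proof.
move=> gl Cy.
(* Since [N (y - p) <= 1], changing the scale by some amount changes the norm by no more. Hence
   admissible scales are closed upwards and under limits, and the infimum is one of them. *)
have H l1 l2 : N (v - l2 *: (y - p)) <= N (v - l1 *: (y - p)) + `|l1 - l2|.
  have -> : v - l2 *: (y - p) = v - l1 *: (y - p) + (l1 - l2) *: (y - p).
    by apply: row2P; rewrite !mxE; ring.
  apply: le_trans (ler_pnormD hN _ _) _; rewrite lerD2l (pnormZ hN).
  by rewrite -[leRHS]mulr1 ler_wpM2l// N_py.
suff Hg : N (v - g v *: (y - p)) <= g v.
  by apply: le_trans (H (g v) l) _; rewrite ler0_norm ?subr_le0//; lra.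
apply/ler_addgt0Pr => e e0.
have e20 : 0 < e / 2 by lra.
have [l' [l'0 Hl'] l'g] := inf_adherent e20 (has_inf_gauge v).
have gl' : g v <= l' by exact: gauge_le.
apply: le_trans (H l' _) _; rewrite ger0_norm ?subr_ge0//.
by have := Hl' _ Cy; rewrite -/(g v) in l'g; lra.
Qed.

Lemma body_gauge v : C (p + v) <-> g v <= 1.
Proof.
have E y : p + v - y = v - 1 *: (y - p).
  by apply: row2P; rewrite !mxE; ring.
split=> [Cv|gv].
  by apply: gauge_le => // y Cy; rewrite -E; exact: C_le1.
by apply: C_complete => y Cy; rewrite E; exact: gaugeP.
Qed.

Lemma ler_gaugeD v w : g (v + w) <= g v + g w.
Proof.
apply: gauge_le => [|y Cy]; first by rewrite addr_ge0 ?gauge_ge0.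
rewrite scalerDl opprD addrACA; apply: le_trans (ler_pnormD hN _ _) _.
by rewrite lerD// gaugeP.
Qed.

Lemma pnorm_le_gauge v : N v <= g v.
Proof.
by have := gaugeP (lexx (g v)) body_center; rewrite subrr scaler0 subr0.
Qed.

Lemma gaugeZ a v : 0 <= a -> g (a *: v) = a * g v.
Proof.
have H a' v' : 0 <= a' -> g (a' *: v') <= a' * g v'.
  move=> a0; apply: gauge_le => [|y Cy]; first by rewrite mulr_ge0 ?gauge_ge0.
  by rewrite -scalerA -scalerBr (pnormZ_ge0 hN)// ler_wpM2l// gaugeP.
rewrite le_eqVlt => /orP[/eqP<-|a0].
  apply/eqP; rewrite eq_le H//= scale0r mul0r; exact: gauge_ge0.
apply/eqP; rewrite eq_le H ?(ltW a0)//=.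
have ai0 : 0 <= a^-1 by rewrite invr_ge0 ltW.
have := H _ (a *: v) ai0; rewrite scalerA mulVf ?gt_eqF// scale1r.
by rewrite mulrC ler_pdivlMr// mulrC.
Qed.

Lemma gauge_gt0 v : v != 0 -> 0 < g v.
Proof.
by move=> v0; apply: lt_le_trans (pnorm_le_gauge v); exact: pnorm_gt0.
Qed.

Lemma continuous_gauge : continuous g.
Proof.
have di0 : 0 < d^-1 by rewrite invr_gt0.
apply: (continuous_lipschitz_pnorm hN di0) => v w; rewrite mulrC.
have Hg v' w' : g v' <= g w' + N (v' - w') / d.
  rewrite -{1}(subrK w' v') addrC; apply: le_trans (ler_gaugeD _ _) _.
  by rewrite lerD2l gauge_le_pnorm.
have := Hg v w; have := Hg w v; rewrite (pnormB hN w) ler_norml => ? ?.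
by apply/andP; split; lra.
Qed.

(** Radial parametrization relative to [p]: the actual boundary point of [C] is [p + boundary t]. *)
Definition boundary t : 'rV[R]_2 := (g (u t))^-1 *: u t.
Local Notation γ := boundary.

Lemma gauge_polar_gt0 t : 0 < g (u t).
Proof. exact/gauge_gt0/polar_neq0. Qed.

Lemma gauge_boundary t : g (γ t) = 1.
Proof.
have gt0 := gauge_polar_gt0 t.
by rewrite gaugeZ ?mulVf ?gt_eqF// invr_ge0 ltW.
Qed.

Lemma boundaryDT t : γ (t + T) = γ t.
Proof. by rewrite /boundary polarDT. Qed.

Lemma boundaryDnT n t : γ (t + T *+ n) = γ t.
Proof. by rewrite /boundary polarDnT. Qed.

Lemma continuous_boundary : continuous γ.
Proof.
move=> t; apply: cvgZ; last exact: continuous_polar.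
apply: cvgV; first by rewrite gt_eqF ?gauge_polar_gt0.
apply: (@continuous_comp _ _ _ u g); first exact: continuous_polar.
exact: continuous_gauge.
Qed.

Lemma body_segment r t : 0 <= r -> r <= 1 -> C (p + r *: γ t).
Proof.
by move=> r0 r1; apply/body_gauge; rewrite gaugeZ// gauge_boundary mulr1.
Qed.

Lemma body_boundary t : C (p + γ t).
Proof. by rewrite -[γ t]scale1r; exact: body_segment. Qed.

Lemma gauge_polarW a v : exists s, [/\ a <= s, s < a + T & v = g v *: γ s].
Proof.
have [->|v0] := eqVneq v 0.
  exists a; split => //; first by rewrite ltrDl mulrn_wgt0// pi_gt0.
  by rewrite -{2}(scale0r 0) gaugeZ// mul0r scale0r.
have [r [s [r0 sa sT ->]]] := polar_surj a v0.
exists s; split => //; rewrite gaugeZ ?(ltW r0)// scalerA mulfK//.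
by rewrite gt_eqF// gauge_polar_gt0.
Qed.

Lemma body_polar a z : C z ->
  exists r s, [/\ 0 <= r, r <= 1, a <= s, s < a + T & z = p + r *: γ s].
Proof.
move=> Cz; have zE : z = p + (z - p) by rewrite addrC subrK.
have [s [sa sT vE]] := gauge_polarW a (z - p).
exists (g (z - p)), s; split => //; first exact: gauge_ge0.
- by apply/body_gauge; rewrite -zE.
- by rewrite -vE.
Qed.


(** * Convex position of boundary points *)

Let r t := (g (u t))^-1.

Let r_gt0 t : 0 < r t.
Proof. by rewrite invr_gt0 gauge_polar_gt0. Qed.

(* Twice the signed area of the triangle with vertices [γ a], [γ b], [γ c]. *)
Definition orient a b c :=
  r a * r b * sin (b - a) + r b * r c * sin (c - b) + r a * r c * sin (a - c).

Let rDT t : r (t + T) = r t. Proof. by rewrite /r polarDT. Qed.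

Let sinDT t : sin (t + T) = sin t. Proof. exact: sinD2pi. Qed.

Lemma orient_rot a b c : orient b c (a + T) = orient a b c.
Proof.
rewrite /orient rDT; have -> : a + T - c = a - c + T by ring.
rewrite sinDT; have -> : b - (a + T) = b - a - T by ring.
rewrite -(sinDT (b - a - T)) subrK; ring.
Qed.

Lemma sin_ge0_le_pi s t : t <= s -> s <= t + pi -> 0 <= sin (s - t).
Proof. by move=> ts st; apply: sin_ge0_pi; rewrite subr_ge0 ts/= lerBlDl. Qed.

Lemma sin_gt0_lt_pi s t : t < s -> s < t + pi -> 0 < sin (s - t).
Proof. by move=> ts st; apply: sin_gt0_pi; rewrite subr_gt0 ts/= ltrBlDl. Qed.

Let orientE a b c : orient a b c = r a * r b * r c *
  (g (u c) * sin (b - a) + g (u a) * sin (c - b) - g (u b) * sin (c - a)).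
Proof.
have ga := gauge_polar_gt0 a; have gb := gauge_polar_gt0 b.
have gc := gauge_polar_gt0 c.
rewrite /orient /r -(opprB c a) sinN; field.
by rewrite !gt_eqF.
Qed.

(** All the sines involved are nonnegative, so the bracket in [orientE] is the defect of
    subadditivity of the gauge along [polar_interp]. *)
Let orient_ge0_half a b c : a <= b -> b <= c -> c <= a + pi ->
  0 <= orient a b c.
Proof.
move=> ab bc ca; rewrite orientE mulr_ge0//.
  by rewrite !mulr_ge0// ltW// r_gt0.
rewrite subr_ge0 mulrC -gaugeZ; last by apply: sin_ge0_le_pi => //; lra.
rewrite polar_interp addrC; apply: le_trans (ler_gaugeD _ _) _.
rewrite !gaugeZ; [|apply: sin_ge0_le_pi; lra..].
by rewrite addrC [in leLHS]mulrC [X in _ + X]mulrC addrC.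
Qed.

(** If one of the three arcs is at least [pi], a rotation of the triple brings the points into a
    half turn. Otherwise each of the three terms of [orient] is nonnegative. *)
Lemma orient_ge0 a b c : a <= b -> b <= c -> c <= a + T -> 0 <= orient a b c.
Proof.
rewrite mulr2n => ab bc ca.
have [?|ac] := leP c (a + pi); first exact: orient_ge0_half.
have [ba|/ltW ba] := leP b (a + pi); last first.
  by rewrite -orient_rot; apply: orient_ge0_half => //; rewrite mulr2n; lra.
have [cb|/ltW cb] := leP c (b + pi); last first.
  rewrite -orient_rot -orient_rot.
  by apply: orient_ge0_half; rewrite mulr2n; lra.
have rr s t : 0 <= r s * r t by rewrite mulr_ge0// ltW// r_gt0.
rewrite !addr_ge0// mulr_ge0//.
- exact: sin_ge0_le_pi.
- exact: sin_ge0_le_pi.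
- have -> : a - c = a + T - c - T by ring.
  by rewrite -sinDT subrK; apply: sin_ge0_le_pi; rewrite mulr2n; lra.
Qed.

(** If no arc exceeded [pi], the three nonnegative terms of [orient] would vanish, forcing
    [b = a + pi] and [c = b + pi], a full turn. The last alternative is the arc from [c] to
    [a + T]. *)
Lemma orient0_gap a b c : a < b -> b < c -> c < a + T -> orient a b c = 0 ->
  [\/ a + pi < b, b + pi < c | c < a + pi].
Proof.
rewrite mulr2n => ab bc ca o0.
have [ba|?] := leP b (a + pi); last by apply: Or31.
have [cb|?] := leP c (b + pi); last by apply: Or32.
have [ac|?] := leP (a + pi) c; last by apply: Or33.
exfalso; have rr s t : 0 < r s * r t by rewrite mulr_gt0// r_gt0.
have s1 : 0 <= sin (b - a) by apply: sin_ge0_le_pi; lra.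
have s2 : 0 <= sin (c - b) by apply: sin_ge0_le_pi; lra.
have s3 : 0 <= sin (a - c).
  have -> : a - c = a + T - c - T by ring.
  by rewrite -sinDT subrK; apply: sin_ge0_le_pi; rewrite mulr2n; lra.
have h1 := mulr_ge0 (ltW (rr a b)) s1; have h2 := mulr_ge0 (ltW (rr b c)) s2.
have h3 := mulr_ge0 (ltW (rr a c)) s3.
move: o0; rewrite /orient => /eqP.
rewrite paddr_eq0 ?addr_ge0// paddr_eq0// => /andP[/andP[/eqP z1 /eqP z2] _].
have bE : b = a + pi.
  apply/eqP; rewrite eq_le ba leNgt; apply/negP => ba'.
  by have := mulr_gt0 (rr a b) (sin_gt0_lt_pi ab ba'); rewrite z1 ltxx.
have cE : c = b + pi.
  apply/eqP; rewrite eq_le cb leNgt; apply/negP => cb'.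
  by have := mulr_gt0 (rr b c) (sin_gt0_lt_pi bc cb'); rewrite z2 ltxx.
lra.
Qed.

(** By [orientE] the gauge is additive along [polar_interp]; dividing that identity by
    [g (u b) * sin (c - a)] makes it a convex combination. *)
Lemma orient0_between a b c : a < b -> b < c -> c < a + pi ->
  orient a b c = 0 ->
  exists l, [/\ 0 <= l, l <= 1 & (1 - l) *: γ a + l *: γ c = γ b].
Proof.
move=> ab bc ca; rewrite orientE => /eqP; rewrite mulf_eq0 gt_eqF/=; last first.
  by rewrite !mulr_gt0// r_gt0.
have ga := gauge_polar_gt0 a; have gb := gauge_polar_gt0 b.
have gc := gauge_polar_gt0 c.
have s1 : 0 < sin (b - a) by apply: sin_gt0_lt_pi => //; lra.
have s2 : 0 < sin (c - b) by apply: sin_gt0_lt_pi => //; lra.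
have s3 : 0 < sin (c - a) by apply: sin_gt0_lt_pi => //; lra.
rewrite subr_eq0 => /eqP E.
have P : 0 < g (u b) * sin (c - a) by rewrite mulr_gt0.
have Q : 0 < g (u a) * sin (c - b) by rewrite mulr_gt0.
have Q' : 0 < g (u c) * sin (b - a) by rewrite mulr_gt0.
exists (g (u c) * sin (b - a) / (g (u b) * sin (c - a))); split.
- by rewrite divr_ge0 ?ltW.
- by rewrite ler_pdivrMr// mul1r -E; lra.
have -> : 1 - g (u c) * sin (b - a) / (g (u b) * sin (c - a)) =
    g (u a) * sin (c - b) / (g (u b) * sin (c - a)).
  rewrite -[X in X - _](@divff _ (g (u b) * sin (c - a))) ?gt_eqF//.
  by rewrite -mulrBl -{1}E; congr (_ / _); ring.
rewrite /boundary !scalerA.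
have -> : g (u a) * sin (c - b) / (g (u b) * sin (c - a)) / g (u a) =
    (g (u b) * sin (c - a))^-1 * sin (c - b) by field; rewrite !gt_eqF.
have -> : g (u c) * sin (b - a) / (g (u b) * sin (c - a)) / g (u c) =
    (g (u b) * sin (c - a))^-1 * sin (b - a) by field; rewrite !gt_eqF.
rewrite -!scalerA -scalerDr -polar_interp scalerA; congr (_ *: _).
by field; rewrite !gt_eqF.
Qed.

(* The orientations of the four triangles are the coefficients of the affine
   dependency between the four points, whose signs give the Radon partition.
   If they all vanish the points are collinear, and the position of the arc
   longer than [pi] tells which point lies between two others. *)
Lemma chords_meet t1 t2 t3 t4 : t1 < t2 -> t2 < t3 -> t3 < t4 -> t4 < t1 + T ->
  exists l m, [/\ 0 <= l <= 1, 0 <= m <= 1 &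
    (1 - l) *: γ t1 + l *: γ t3 = (1 - m) *: γ t2 + m *: γ t4].
Proof.
move=> t12 t23 t34 t41.
have o1 : 0 <= orient t2 t3 t4 by apply: orient_ge0; lra.
have o2 : 0 <= orient t1 t3 t4 by apply: orient_ge0; lra.
have o3 : 0 <= orient t1 t2 t4 by apply: orient_ge0; lra.
have o4 : 0 <= orient t1 t2 t3 by apply: orient_ge0; lra.
have E : orient t2 t3 t4 + orient t1 t2 t4 = orient t1 t3 t4 + orient t1 t2 t3.
  rewrite /orient !sinB; move: (r t1) (r t2) (r t3) (r t4) (sin t1) (sin t2)
    (sin t3) (sin t4) (cos t1) (cos t2) (cos t3) (cos t4) => *; ring.
have V : orient t2 t3 t4 *: γ t1 + orient t1 t2 t4 *: γ t3 =
    orient t1 t3 t4 *: γ t2 + orient t1 t2 t3 *: γ t4.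
  apply: row2P; rewrite /boundary -!/(r _) !mxE/= !(mulr1, mulr0, addr0, add0r);
    rewrite /orient !sinB; move: (r t1) (r t2) (r t3) (r t4) (sin t1) (sin t2)
    (sin t3) (sin t4) (cos t1) (cos t2) (cos t3) (cos t4) => *; ring.
have [S0|S0] := eqVneq (orient t2 t3 t4 + orient t1 t2 t4) 0.
  have [|||] := orient0_gap t12 t23 (lt_trans t34 t41).
  - lra.
  - move=> gap; have [||||l [l0 l1 <-]] := @orient0_between t2 t3 t4 => //.
    + by move: t41; rewrite mulr2n; lra.
    + lra.
    + by exists 1, l; rewrite subrr scale0r add0r scale1r lexx ler01 l0 l1.
  - move=> gap.
    have [||||l [l0 l1 El]] := @orient0_between t3 t4 (t1 + T) => //.
    + by rewrite mulr2n; lra.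
    + by rewrite orient_rot; lra.
    + exists (1 - l), 1; rewrite subrr scale0r add0r scale1r lexx ler01 subKr.
      split => //; first by rewrite subr_ge0 l1 gerBl.
      by rewrite -El boundaryDT addrC.
  - move=> gap; have [||||l [l0 l1 El]] := @orient0_between t1 t2 t3 => //.
    + lra.
    + by exists l, 0; rewrite subr0 scale0r addr0 scale1r lexx ler01 l0 l1.
set S := orient t2 t3 t4 + orient t1 t2 t4 in E S0.
have Sp : 0 < S by rewrite lt_neqAle eq_sym S0 addr_ge0.
exists (orient t1 t2 t4 / S), (orient t1 t2 t3 / S); split.
- by rewrite divr_ge0 ?(ltW Sp)//= ler_pdivrMr// mul1r /S lerDr.
- by rewrite divr_ge0 ?(ltW Sp)//= ler_pdivrMr// mul1r E lerDr.
have -> : 1 - orient t1 t2 t4 / S = S^-1 * orient t2 t3 t4.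
  by rewrite -[1](divff S0) -mulrBl mulrC {2}/S addrK.
have -> : 1 - orient t1 t2 t3 / S = S^-1 * orient t1 t3 t4.
  by rewrite -[1](divff S0) -mulrBl mulrC {2}E addrK.
by rewrite ![_ / S]mulrC -!scalerA -!scalerDr V.
Qed.

(** * Distances between boundary points *)

Definition bdist s t := N (γ s - γ t).

Lemma bdist_sym s t : bdist s t = bdist t s.
Proof. exact: pnormB. Qed.

Lemma bdistDT s t : bdist s (t + T) = bdist s t.
Proof. by rewrite /bdist boundaryDT. Qed.

Lemma bdist0 t : bdist t t = 0.
Proof. by rewrite /bdist subrr (pnorm0 hN). Qed.

Lemma bdist_le1 s t : bdist s t <= 1.
Proof.
rewrite /bdist -[γ s](addrK p) [γ s + p]addrC -addrA -opprD.
by apply: C_le1; exact: body_boundary.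
Qed.

Lemma boundary_le t : N (γ t) <= 1 - d.
Proof.
have := p_center (body_boundary t).
by rewrite opprD addNKr (pnormN hN).
Qed.

(** Through the intersection point [q] of the diagonals, the triangle inequality bounds the two
    opposite sides, of total length 2, by the two diagonals, each of length at most 1. *)
Lemma bdist_cross a b c e : a < b -> b < c -> c < e -> e < a + T ->
  bdist a e = 1 -> bdist b c = 1 -> bdist a c = 1 /\ bdist b e = 1.
Proof.
move=> ab bc ce ea; rewrite /bdist => Dae Dbc.
have [l [m [/andP[l0 l1] /andP[m0 m1] lm]]] := chords_meet ab bc ce ea.
set q := (1 - l) *: γ a + l *: γ c in lm.
have qa : N (γ a - q) = l * bdist a c.
  rewrite -(pnormZ_ge0 hN)//; congr N; apply: row2P; rewrite !mxE; ring.
have qc : N (q - γ c) = (1 - l) * bdist a c.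
  rewrite -(pnormZ_ge0 hN) ?subr_ge0//; congr N.
  by apply: row2P; rewrite !mxE; ring.
have qb : N (γ b - q) = m * bdist b e.
  rewrite lm -(pnormZ_ge0 hN)//; congr N; apply: row2P; rewrite !mxE; ring.
have qe : N (q - γ e) = (1 - m) * bdist b e.
  rewrite lm -(pnormZ_ge0 hN) ?subr_ge0//; congr N.
  by apply: row2P; rewrite !mxE; ring.
have := ler_pnorm_trans hN q (γ a) (γ e).
have := ler_pnorm_trans hN q (γ b) (γ c).
rewrite Dae Dbc qa qb qc qe -/(bdist a c) -/(bdist b e).
by have := bdist_le1 a c; have := bdist_le1 b e => ? ? ? ?; split; lra.
Qed.

Lemma near_boundary t e : 0 < e ->
  exists2 e', 0 < e' & forall s, `|s - t| < e' -> N (γ t - γ s) < e.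
Proof.
move=> e0.
have /nbhs_ballP[e' /= e'0 He'] := continuous_boundary (near_pnorm hN (γ t) e0).
by exists e' => // s st; apply: He'; rewrite /ball/= distrC.
Qed.

Lemma bdist_open s t : bdist s t < 1 -> exists2 e, 0 < e &
  forall s' t', `|s' - s| < e -> `|t' - t| < e -> bdist s' t' < 1.
Proof.
move=> st1; have e0 : 0 < (1 - bdist s t) / 2 by lra.
have [e1 e10 He1] := near_boundary s e0.
have [e2 e20 He2] := near_boundary t e0.
exists (Num.min e1 e2); first by rewrite lt_min e10.
move=> s' t'; rewrite !lt_min => /andP[/He1 Hs _] /andP[_ /He2 Ht].
have := ler_pnorm_trans hN (γ s) (γ s') (γ t').
have := ler_pnorm_trans hN (γ t) (γ s) (γ t').
by rewrite (pnormB hN (γ s') (γ s)) -/(bdist s' t') -/(bdist s t) => ? ?; lra.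
Qed.

Let continuous_bdist : continuous (fun z : R * R => bdist z.1 z.2).
Proof.
move=> z; apply: (@continuous_comp _ _ _ (fun z : R * R => γ z.1 - γ z.2) N).
  apply: cvgB.
    apply: (@continuous_comp _ _ _ (fun z : R * R => z.1) γ); first exact: cvg_fst.
    exact: continuous_boundary.
  apply: (@continuous_comp _ _ _ (fun z : R * R => z.2) γ); first exact: cvg_snd.
  exact: continuous_boundary.
exact: continuous_pnorm.
Qed.

Lemma bdist_rectangle_max a b c e : a <= b -> c <= e ->
  exists s t, [/\ s \in `[a, b], t \in `[c, e] &
    forall s' t', s' \in `[a, b] -> t' \in `[c, e] -> bdist s' t' <= bdist s t].
Proof.
move=> ab ce.
have [|||[s t]] := @compact_EVT_max _ R (fun z : R * R => bdist z.1 z.2)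
    (`[a, b]%classic `*` `[c, e]%classic).
- by exists (a, c); split; rewrite /= in_itv/= lexx.
- by apply: compact_setX; exact: segment_compact.
- exact: continuous_subspaceT continuous_bdist.
rewrite inE => -[/= sab tce] M; exists s, t; split => // s' t' sab' tce'.
by apply: (M (s', t')); rewrite inE.
Qed.

(* Otherwise [γ t] could be pushed outwards while staying at distance at most 1
   from all of [C], against completeness. *)
Lemma bdist_ex t : exists s, [/\ t < s, s < t + T & bdist t s = 1].
Proof.
have T0 : 0 < T by rewrite mulrn_wgt0// pi_gt0.
have tT : t <= t + T by rewrite lerDl ltW.
have [t' [s [tt st M]]] := bdist_rectangle_max (lexx t) tT.
have t'E : t' = t by move: tt; rewrite in_itv/= -eq_le => /eqP.
move: M; rewrite t'E => M; clear tt t'E t'.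
move: st; rewrite in_itv/= => /andP[ts sT].
have [Ds|Ds] := eqVneq (bdist t s) 1.
  exists s; split => //.
    rewrite lt_neqAle ts andbT; apply/eqP => tE.
    by move: Ds; rewrite -tE bdist0 => /eqP; rewrite eq_sym oner_eq0.
  rewrite lt_neqAle sT andbT; apply/eqP => tE.
  by move: Ds; rewrite tE bdistDT bdist0 => /eqP; rewrite eq_sym oner_eq0.
have {}Ds : bdist t s < 1 by rewrite lt_neqAle Ds bdist_le1.
(* By convexity [m] bounds the distance from [γ t] to every point of [C - p], leaving room for an
   outward push by [(1 - m) *: γ t], a vector of norm at most [1 - m]. *)
pose m := Num.max (bdist t s) (1 - d).
have m1 : m < 1 by rewrite gt_max Ds; have := d0; lra.
have : C (p + (2 - m) *: γ t).
  apply: C_complete => y Cy.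
  have [r' [s' [r'0 r'1 ts' sT' yE]]] := body_polar t Cy.
  have Hm : N (γ t - r' *: γ s') <= m.
    rewrite (pnormB hN) -[r' *: γ s']add0r -(scaler0 _ (1 - r')).
    apply: le_trans (pnorm_conv_sub hN _ _ _ r'0 r'1) _.
    have h1 : N (0 - γ t) <= m.
      rewrite sub0r (pnormN hN) (le_trans (boundary_le t))//.
      by rewrite le_max lexx orbT.
    have h2 : N (γ s' - γ t) <= m.
      rewrite (pnormB hN) -/(bdist t s') (le_trans (M t s' _ _))//.
      - by rewrite in_itv/= lexx.
      - by rewrite in_itv/= ts' ltW.
      - by rewrite le_max lexx.
    have := ler_wpM2l r'0 h2; have r'10 : 0 <= 1 - r' by lra.
    by have := ler_wpM2l r'10 h1; lra.
  rewrite yE (_ : _ - _ = (γ t - r' *: γ s') + (1 - m) *: γ t); last first.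
    by apply: row2P; rewrite !mxE; ring.
  apply: le_trans (ler_pnormD hN _ _) _; rewrite (pnormZ_ge0 hN); last lra.
  have m0 : 0 <= 1 - m by lra.
  by have := ler_wpM2l m0 (boundary_le t); have := mulr_ge0 m0 (ltW d0); lra.
by move/body_gauge; rewrite gaugeZ ?gauge_boundary; lra.
Qed.

(** * The two bounds on the size of a cover *)

Lemma body_cover_card k m : (0 < k)%N -> diam N C = 1%:E ->
  has_kfold_cover N k C m -> (2 * k + 1 <= m)%N.
Proof.
move=> k0 diam1 [F [FC Fk]].
(* The angles whose boundary point lies in the closure of [F i]. The bound [M < 1] on distances in
   [F i] passes to the closure. *)
pose G (i : 'I_m) : set R :=
  fun t => forall e, 0 < e -> exists2 z, F i z & N (p + γ t - z) < e.
have := circle_closed_cover_card bdist0 bdist_le1 bdist_open bdist_ex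
  (G := G) k0.
apply=> [i t nG|i s t Gs Gt|t].
- have [e [e0 He]] : exists e, 0 < e /\ forall z, F i z -> e <= N (p + γ t - z).
    apply: contrapT => H; apply: nG => e e0; apply: contrapT => H'; apply: H.
    exists e; split => // z Fz; rewrite leNgt; apply/negP => Hz; apply: H'.
    by exists z.
  have e20 : 0 < e / 2 by lra.
  have [e' e'0 He'] := near_boundary t e20.
  exists e' => // s /He' st /(_ _ e20)[z Fz sz].
  have := He _ Fz; have := ler_pnorm_trans hN (p + γ s) (p + γ t) z.
  rewrite (_ : p + γ t - (p + γ s) = γ t - γ s); first lra.
  by rewrite opprD addrACA subrr add0r.
- have [M M1 HM] : exists2 M, M < 1 &
      forall x y, F i x -> F i y -> N (x - y) <= M.
    by apply: diam_lt1; rewrite -diam1; case: (FC i).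
  have e0 : 0 < (1 - M) / 2 by lra.
  have [z Fz sz] := Gs _ e0; have [z' Fz' tz] := Gt _ e0.
  have := HM _ _ Fz Fz'.
  have := ler_pnorm_trans hN z (p + γ s) (p + γ t).
  have := ler_pnorm_trans hN z' z (p + γ t).
  rewrite (pnormB hN z' (_ + _)) (_ : p + γ s - (p + γ t) = γ s - γ t).
    by rewrite /bdist; lra.
  by rewrite opprD addrACA subrr add0r.
- apply: leq_trans (Fk _ (body_boundary t)) _.
  apply: subset_leq_card; apply/fintype.subsetP => i; rewrite !inE => Fi.
  by move=> e e0; exists (p + γ t) => //; rewrite subrr (pnorm0 hN).
Qed.

Lemma body_cover k : complete_set N C -> diam N C = 1%:E ->
  ~ reuleaux_polygon N C -> has_kfold_cover N k C (2 * k + 1)%N.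
Proof.
move=> Ccompl diam1 nR.
have [[n [v Hv]]|/(_ k)[y [yT ylt yD]]] := circle_dichotomy bdist_sym bdistDT
    bdist0 bdist_le1 bdist_open bdist_ex bdist_cross.
  case: nR; split => //; exists [seq p + γ (v j) | j <- iota 0 n].
  apply/seteqP; split => [z Cz _ /mapP[j _ ->]|z Hz].
    exists (z - (p + γ (v j))); last by rewrite addrC subrK.
    by apply: C_le1 => //; exact: body_boundary.
  rewrite -(subrK p z) addrC; apply/body_gauge.
  (* If [z] is outside [C], the boundary point on the ray from [p] to [z] is a proper convex
     combination of the two. Its distance to [p + γ (v j)] would be below 1, since that of [z] is at
     most 1 and that of [p] at most [1 - d]. *)
  rewrite leNgt; apply/negP => gz1.
  have [s [sT s0 zE]] := gauge_polarW (- T) (z - p).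
  have [|j jn Ds] := Hv s sT; first by rewrite ltW// (lt_le_trans s0)// addNr.
  have [|b Bb bz] := Hz (p + γ (v j)).
    by apply/mapP; exists j => //; rewrite mem_iota add0n.
  set G := g (z - p) in gz1 zE.
  have G0 : 0 < G by lra.
  have Gi0 : 0 <= G^-1 by rewrite invr_ge0 ltW.
  have Gi1 : G^-1 < 1 by rewrite invf_lt1.
  have := pnorm_conv_sub hN 0 (G *: γ s) (γ (v j)) Gi0 (ltW Gi1).
  rewrite scaler0 add0r scalerA mulVf ?gt_eqF// scale1r -/(bdist _ _) Ds.
  rewrite -zE (_ : z - p - γ (v j) = b); last first.
    by rewrite -bz; apply: row2P; rewrite !mxE; ring.
  rewrite sub0r (pnormN hN); have Gi1' : 0 <= 1 - G^-1 by lra.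
  have := ler_wpM2l Gi1' (boundary_le (v j)); have := ler_wpM2l Gi0 Bb.
  have Gi1'' : 0 < 1 - G^-1 by lra.
  by have := mulr_gt0 Gi1'' d0; lra.
pose F (i : 'I_(2 * k + 1)) := [set z | exists r' t, [/\ 0 <= r', r' <= 1,
  y i <= t, t <= y i.+1 & z = p + r' *: γ t]].
have ik (i : 'I_(2 * k + 1)) : (i < (2 * k).+1)%N.
  by rewrite -[X in (_ < X)%N]addn1.
exists F; split => [i|z Cz]; first split.
- by move=> z [r' [t [r'0 r'1 _ _ ->]]]; exact: body_segment.
- have [M M1 HM] : exists2 M, M < 1 & forall s t, y i <= s -> s <= y i.+1 ->
      y i <= t -> t <= y i.+1 -> bdist s t <= M.
    (* The chain need not increase; where it decreases the sector is empty. *)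
    have [yy|yy] := leP (y i) (y i.+1); last by exists 0 => // s t; lra.
    have [s [t [sy ty M]]] := bdist_rectangle_max yy yy.
    exists (bdist s t) => [|s' t' h1 h2 h3 h4].
      by move: sy ty; rewrite !in_itv/= => /andP[? ?] /andP[? ?]; exact: (yD i).
    by apply: M; rewrite in_itv/=; apply/andP.
  (* Distance is convex in each endpoint, so it suffices to bound it when both are [p] or on the
     arc: the values are 0, at most [1 - d], or at most [M]. *)
  set m := Num.max M (1 - d).
  rewrite diam1; apply: le_lt_trans (_ : m%:E < _)%E; last first.
    by rewrite lte_fin gt_max M1; have := d0; lra.
  apply: diam_le => _ _ [r1 [s [r10 r11 ys sy ->]]] [r2 [t [r20 r21 yt ty ->]]].
  have mM : M <= m by rewrite le_max lexx.
  have md : 1 - d <= m by rewrite le_max lexx orbT.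
  have bm s' : N (0 - γ s') <= m.
    by rewrite sub0r (pnormN hN) (le_trans (boundary_le _)).
  have conv0 r' w z' : 0 <= r' -> r' <= 1 ->
      N (0 - z') <= m -> N (w - z') <= m -> N (r' *: w - z') <= m.
    move=> r'0 r'1 h1 h2; rewrite -[r' *: w]add0r -(scaler0 _ (1 - r')).
    apply: le_trans (pnorm_conv_sub hN _ _ _ r'0 r'1) _.
    have r'10 : 0 <= 1 - r' by lra.
    by have := ler_wpM2l r'0 h2; have := ler_wpM2l r'10 h1; lra.
  rewrite opprD addrACA subrr add0r.
  have m0 : 0 <= m by rewrite (le_trans _ (bm 0))// (pnorm_ge0 hN).
  apply: (conv0) => //.
    rewrite (pnormB hN); apply: (conv0) => //.
      by rewrite subrr (pnorm0 hN).
    by rewrite (pnormB hN).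
  rewrite (pnormB hN); apply: (conv0) => //.
  by rewrite -/(bdist t s) bdist_sym (le_trans _ mM)// HM.
have [r' [s [r'0 r'1 ys sy zE]]] := body_polar (y 0%N) Cz.
have T0 : 0 < T by rewrite mulrn_wgt0// pi_gt0.
(* The [k] lifts [s + T *+ l] of the angle of [z] all lie between [y 0] and [y 0 + T *+ k], so each
   falls in some arc. Arcs are shorter than [T], so no two lifts share one. *)
have /choice[φ Hφ] (l : 'I_k) : exists i : 'I_(2 * k + 1),
    y i <= s + T *+ l /\ s + T *+ l < y i.+1.
  have [||j [jk yj]] := @nat_crossing _ y (s + T *+ l) (2 * k).+1.
  - by rewrite (le_trans ys)// lerDl mulrn_wge0// ltW.
  - rewrite yT (lt_le_trans (_ : _ < y 0%N + T + T *+ l))//.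
      by rewrite ltrD2r.
    by rewrite -addrA lerD2l -mulrS ler_pMn2l.
  rewrite -[X in (_ < X)%N]addn1 in jk; by exists (Ordinal jk).
have φ_inj : injective φ.
  move=> l l' ll; have [h1 h2] := Hφ l; have [h3 h4] := Hφ l'.
  rewrite -ll in h3 h4; have hT := ylt _ (ik (φ l)).
  have aux (i j : nat) : (i < j)%N -> s + T *+ j < s + T *+ i + T -> False.
    move=> ij; rewrite -addrA ltrD2l -mulrSr ltNge => /negP; apply.
    by rewrite ler_pMn2l.
  apply/val_inj; have [lll|lll|//] := ltngtP (val l) (val l').
    by case: (aux _ _ lll); lra.
  by case: (aux _ _ lll); lra.
rewrite -[k in (k <= _)%N]card_ord -(card_codom φ_inj).
apply: subset_leq_card; apply/fintype.subsetP => _ /codomP[l ->]; rewrite !inE.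
have [h1 h2] := Hφ l; exists r', (s + T *+ l); split => //; first exact: ltW.
by rewrite boundaryDnT.
Qed.

End Body.

(** * Existence of a uniformly interior point *)

Section Center.
Context {R : realType} (N : 'rV[R]_2 -> R).
Hypothesis hN : is_norm N.
Context (C : set 'rV[R]_2).
Hypothesis C0 : C !=set0.
Hypothesis C_le1 : forall x y, C x -> C y -> N (x - y) <= 1.

(** [C] lies in a compact coordinate box, which finitely many open [N]-balls of radius [e / 2]
    cover. *)
Lemma finite_net e : 0 < e -> exists cs : seq 'rV[R]_2,
  (forall c, c \in cs -> C c) /\
  forall y, C y -> exists2 c, c \in cs & N (c - y) <= e.
Proof.
move=> e0; have [x0 Cx0] := C0; have [m m0 Hm] := pnorm_coord_le hN.
pose K := [set v : 'rV[R]_2 | forall i, v ord0 i \in `[x0 0 i - m, x0 0 i + m]].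
have Kc : compact K.
  apply: (@rV_compact _ _ (fun i => `[x0 0 i - m, x0 0 i + m]%classic)).
  by move=> i; exact: segment_compact.
have CK v : C v -> K v.
  move=> Cv i; rewrite in_itv/= -ler_distl.
  have := Hm (v - x0) i; rewrite !mxE => /le_trans; apply.
  by rewrite -[leRHS]mulr1 ler_wpM2l ?(ltW m0)// C_le1.
have e20 : 0 < e / 2 by lra.
pose B (x : 'rV[R]_2) := [set y | N (x - y) < e / 2].
have Bo x : open (B x).
  rewrite openE => y /= xy.
  have h : 0 < e / 2 - N (x - y) by rewrite subr_gt0.
  apply: (@filterS _ _ (nbhs_filter y)) (near_pnorm hN y h) => z yz /=.
  by have := ler_pnorm_trans hN y x z; move: yz; rewrite /B/=; lra.
move: Kc; rewrite compact_cover => /(_ _ setT B) [v _|v _|D _ KD].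
- exact: Bo.
- by exists v => //; rewrite /B/= subrr (pnorm0 hN).
(* Each ball that meets [C] gets a centre in [C]; halving the radius pays for the move. *)
have /choice[f Hf] x : exists c, C c /\ forall y, C y -> B x y -> B x c.
  have [[y [Cy xy]]|H] := pselect (exists y, C y /\ B x y); first by exists y.
  by exists x0; split => // y Cy xy; case: H; exists y.
exists [seq f x | x <- finmap.enum_fset D]; split => [c /mapP[x _ ->]|y Cy].
  by case: (Hf x).
have [x /= xD xy] := KD _ (CK _ Cy); exists (f x); first exact: map_f.
have [_ /(_ _ Cy xy) xf] := Hf x.
have := ler_pnorm_trans hN x (f x) y.
by rewrite (pnormB hN (f x) x) /B/= in xf xy *; lra.
Qed.

(* The barycentre of a finite 1/2-net is at distance less than one from [C],
   uniformly: at least one of the averaged distances is at most 1/2. *)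
Lemma exists_center : exists p d, 0 < d /\ forall y, C y -> N (p - y) <= 1 - d.
Proof.
have half0 : 0 < 1 / 2 :> R by lra.
have [cs [csC net]] := finite_net half0.
pose n : R := (size cs)%:R.
have n0 : 0 < n.
  have [x0 /net[c]] := C0.
  by rewrite /n ltr0n; case: cs {csC net n}.
exists (n^-1 *: \sum_(c <- cs) c), (1 / (2 * n)); split.
  by rewrite divr_gt0// mulr_gt0.
move=> y Cy.
have sumB (s : seq 'rV[R]_2) :
    \sum_(c <- s) (c - y) = \sum_(c <- s) c - (size s)%:R *: y.
  elim: s => [|c s IHs]; first by rewrite !big_nil scale0r subr0.
  rewrite !big_cons IHs /= -natr1 scalerDl scale1r opprD addrACA.
  by rewrite [- y + _]addrC.
have -> : n^-1 *: (\sum_(c <- cs) c) - y = n^-1 *: \sum_(c <- cs) (c - y).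
  by rewrite sumB scalerBr scalerA mulVf ?gt_eqF// scale1r.
rewrite (pnormZ_ge0 hN) ?invr_ge0 ?(ltW n0)// [leLHS]mulrC ler_pdivrMr//.
have -> : (1 - 1 / (2 * n)) * n = n - 1 / 2 by field; rewrite gt_eqF.
have tri (s : seq 'rV[R]_2) :
    N (\sum_(c <- s) (c - y)) <= \sum_(c <- s) N (c - y).
  elim: s => [|c s IHs]; first by rewrite !big_nil (pnorm0 hN).
  by rewrite !big_cons (le_trans (ler_pnormD hN _ _))// lerD2l.
apply: le_trans (tri cs) _; have [c ccs cy] := net y Cy.
rewrite (perm_big _ (perm_to_rem ccs)) big_cons /=.
have -> : n = 1 + (size (rem c cs))%:R.
  by rewrite /n (perm_size (perm_to_rem ccs)) /= -nat1r.
suff : \sum_(j <- rem c cs) N (j - y) <= (size (rem c cs))%:R by lra.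
have : forall j, j \in rem c cs -> C j by move=> j /mem_rem /csC.
elim: (rem c cs) => [|j s IHs] sC; first by rewrite big_nil.
rewrite big_cons /= -nat1r lerD//.
  by apply: C_le1 => //; apply: sC; rewrite mem_head.
by apply: IHs => i si; apply: sC; rewrite inE si orbT.
Qed.

End Center.

(** Adding such a [z] to [C] leaves the diameter at 1, so maximality of [C] forces [z] to be in it
    already. *)
Lemma complete_set_mem (R : realType) (N : 'rV[R]_2 -> R) (C : set 'rV[R]_2) :
  is_norm N -> complete_set N C -> diam N C = 1%:E ->
  forall z, (forall y, C y -> N (z - y) <= 1) -> C z.
Proof.
move=> hN [_ Cmax] diam1 z zC; apply: contrapT => nCz; apply: Cmax.
exists (C `|` [set z]); split.
  split; first by move=> x Cx; left.
  by move=> /(_ z) H; apply/nCz/H; right.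
have C_le1 x y : C x -> C y -> N (x - y) <= 1.
  by move=> Cx Cy; rewrite -lee_fin -diam1 le_diam.
apply/eqP; rewrite eq_le; apply/andP; split.
  rewrite diam1; apply: diam_le => x y [Cx|->] [Cy|->].
  - exact: C_le1.
  - by rewrite (pnormB hN) zC.
  - exact: zC.
  - by rewrite subrr (pnorm0 hN).
apply: ge_ereal_sup => _ [x Cx [y Cy <-]].
by apply: le_diam; left.
Qed.

Theorem theorem3 (R : realType) (N : 'rV[R]_2 -> R) (hN : is_norm N)
    (C : set 'rV[R]_2) (hC : complete_set N C) (hdiam : diam N C = 1%:E)
    (hnR : ~ reuleaux_polygon N C) (k : nat) (hk : (0 < k)%N) :
  is_kfold_borsuk_number N k C (2 * k + 1)%N.
Proof.
have C_compl := complete_set_mem hN hC hdiam.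
have C_le1 x y : C x -> C y -> N (x - y) <= 1.
  by move=> Cx Cy; rewrite -lee_fin -hdiam le_diam.
have C0 : C !=set0.
  apply/set0P/eqP => C0.
  have : (diam N C <= 0%:E)%E by apply: diam_le => x y; rewrite C0.
  by rewrite hdiam lee_fin ler10.
have [p [d [d0 pd]]] := exists_center hN C0 C_le1.
split; first exact: (body_cover hN C_le1 C_compl d0 pd).
by move=> m; exact: (body_cover_card hN C_le1 C_compl d0 pd).
Qed.
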